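(* Let $Z$ be a continuous random variable with density $f$, CDF $F$, finite expectation, and support unbounded on the right. Suppose that for some $\alpha\in[0,1)$ and $C>0$ the generalized hazard rate satisfies $h_\alpha(z) \le C$ for all $z\in\mathbb{R}$, and that $$\mathbb{E}\big[\max_{i=1,\dots,N} Z_i\big] - \mathbb{E}[Z_1] \le Q(N)$$ for some $Q(N)>0$, where $Z_1,\dots,Z_N$ are i.i.d. copies of $Z$. Run GBPA with the stochastically smoothed potential whose perturbation is $\eta Z$ with $$\eta = \left(\frac{2CNT}{(1-\alpha)Q(N)}\right)^{1/(2-\alpha)}.$$ Then for every gain sequence $g_1,\dots,g_T\in[-1,0]^N$ the expected regret is at most $$2\left(\frac{2C}{1-\alpha}\right)^{1/(2-\alpha)} (NT)^{1/(2-\alpha)}\, Q(N)^{(1-\alpha)/(2-\alpha)}.$$ In particular, the expected regret is sublinear in $T$.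
   Context: Generalized hazard rate: for $\alpha\in[0,1)$, $h_\alpha(z) = \frac{f(z)|z|^\alpha}{(1-F(z))^{1-\alpha}}$ (for $\alpha=0$ this is the usual hazard rate). Adversarial multi-armed bandit: $N$ arms, $T$ rounds; an oblivious adversary fixes gain vectors $g_1,\dots,g_T \in [-1,0]^N$ in advance. For a random variable $W$ with a continuous distribution and finite expectation, the stochastically smoothed potential is $\tilde\Phi(G) = \mathbb{E}[\max_{i}(G_i + W_i)]$ for $G\in\mathbb{R}^N$, with $W_1,\dots,W_N$ i.i.d. copies of $W$; $\nabla_i\tilde\Phi(G) = \mathbb{P}(i = \arg\max_j (G_j+W_j))$. ''Perturbation $\eta Z$'' means $W=\eta Z$. GBPA$(\tilde\Phi)$: set $\hat G_0 = 0$; for $t=1,\dots,T$: $p_t = \nabla\tilde\Phi(\hat G_{t-1})$, draw $i_t \sim p_t$, observe only $g_{t,i_t}$, set $\hat g_t = \frac{g_{t,i_t}}{p_{t,i_t}} e_{i_t}$, $\hat G_t = \hat G_{t-1} + \hat g_t$. Expected regret: $\mathbb{E}\big[\max_{i}\sum_{t=1}^T (g_{t,i} - g_{t,i_t})\big]$ over the learner's randomness. *)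

(* Defs.v *)
From HB Require Import structures.
From mathcomp Require Import all_boot all_order all_algebra.
From mathcomp Require Import all_classical all_reals all_analysis.
Set Implicit Arguments. Unset Strict Implicit. Unset Printing Implicit Defensive.
Import Order.TTheory GRing.Theory Num.Def Num.Theory.
Import numFieldNormedType.Exports.
Local Open Scope classical_set_scope.
Local Open Scope ring_scope.

Section Defs.
Context {R : realType}.

(** maximum of a finite family of reals indexed by 'I_N (meaningful for
    N > 0: the default value is one of the v i, and max is idempotent) *)
Definition maxI (N : nat) (v : 'I_N -> R) : R :=
  \big[Num.max/head 0 [seq v i | i <- enum 'I_N]]_(i < N) v i.

Definition cdf_of (f : R -> R) (z : R) : R :=
  fine (\int[@lebesgue_measure R]_(x in `]-oo, z]) (f x)%:E)%E.

Definition gen_hazard (f : R -> R) (alpha : R) (z : R) : R :=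
  f z * `|z| `^ alpha / (1 - cdf_of f z) `^ (1 - alpha).

Definition mutually_independent d (T : measurableType d) (P : probability T R)
  (N : nat) (X : 'I_N -> T -> R) : Prop :=
  forall (J : {set 'I_N}) (B : 'I_N -> set R),
    (forall j, measurable (B j)) ->
    P (\bigcap_(j in [set j | j \in J]) (X j @^-1` B j)) =
      (\prod_(j in J) P (X j @^-1` B j))%E.

Definition has_density d (T : measurableType d) (P : probability T R)
  (X : T -> R) (f : R -> R) : Prop :=
  forall A : set R, measurable A ->
    P (X @^-1` A) = (\int[@lebesgue_measure R]_(x in A) (f x)%:E)%E.

(** gradient of the stochastically smoothed potential with perturbation
    W_j = eta * X_j:  grad G i = P(i = argmax_j (G_j + W_j)) *)
Definition smooth_grad d (T : measurableType d) (P : probability T R)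
  (N : nat) (X : 'I_N -> T -> R) (eta : R) (G : 'I_N -> R) (i : 'I_N) : R :=
  fine (P [set w | forall j, j != i -> G j + eta * X j w < G i + eta * X i w]).

Definition gbpa_step (N : nat) (grad : ('I_N -> R) -> 'I_N -> R)
  (g : nat -> 'I_N -> R) (t : nat) (G : 'I_N -> R) (i : 'I_N) : 'I_N -> R :=
  fun j => G j + (if j == i then g t i / grad G i else 0).

Fixpoint gbpa_prob (N : nat) (grad : ('I_N -> R) -> 'I_N -> R)
  (g : nat -> 'I_N -> R) (t : nat) (G : 'I_N -> R) (s : seq 'I_N) : R :=
  match s with
  | [::] => 1
  | i :: s' => grad G i * gbpa_prob grad g t.+1 (gbpa_step grad g t G i) s'
  end.

(** expected regret of GBPA over T rounds (gains g_1..g_T are g 0 .. g (T-1)):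
    E[ max_i sum_t (g_{t,i} - g_{t,i_t}) ] over the learner's randomness *)
Definition gbpa_expected_regret (N T : nat) (grad : ('I_N -> R) -> 'I_N -> R)
  (g : nat -> 'I_N -> R) : R :=
  \sum_(s : T.-tuple 'I_N)
    gbpa_prob grad g 0 (fun _ => 0) s *
    maxI (fun i => \sum_(t < T) (g t i - g t (tnth s t))).

End Defs.

(* Main.v *)
Require Import Defs.
From HB Require Import structures.
From mathcomp Require Import all_boot all_order all_algebra.
From mathcomp Require Import all_classical all_reals all_analysis.
From mathcomp Require Import measurable_realfun.
From mathcomp Require Import ring lra.
Import Order.TTheory GRing.Theory Num.Def Num.Theory.
Import numFieldNormedType.Exports.
Local Open Scope classical_set_scope.
Local Open Scope ring_scope.

(** Write [Phi] for the smoothed potential, [p] for its gradient at the current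
    estimate [G], [b = 1 - alpha] and [S = 1 - F].  Convexity of [Phi] bounds
    the Bregman divergence of a step [- s e_i] by
    [s (p_i(G) - p_i(G - s e_i))], so no second derivative is needed.  With [Y]
    the (independent of [X_i]) threshold that [X_i] must exceed for arm [i] to
    win, the difference is [P(Y < X_i <= Y + s / eta)].  The hazard bound reads
    [f z <= C |z|^(b-1) S(z)^b], and integrating it over an interval of length
    [u] gives [P(y < X <= y + u) <= (2 C / b) u^b S(y)^b]; averaging over [Y]
    (Jensen for [x^b]) turns [S(Y)^b] into [p_i^b].  As [s <= 1 / p_i], the
    divergence weighted by [p_i] is at most [(2 C / b) eta^(-b)] per arm and per
    round.  Telescoping [Phi] along the play, the regret is at most
    [eta Q + N T (2 C / b) eta^(-b)], and [eta] makes both terms equal. *)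

(** * Real powers and the integral of [|z|^(b-1)] *)

(** Convexity of the exponential between [ln x] and [0]. The right side is the tangent of [x ^ b] at
    [1]; rescaled, it stands in for Jensen's inequality later. *)
Lemma powR_le_affine (R : realType) (x b : R) :
  0 <= x -> 0 < b <= 1 -> x `^ b <= 1 - b + b * x.
Proof.
move=> x0 /andP[b0 b1]; have [->|xN0] := eqVneq x 0.
  by rewrite powR0 ?gt_eqF// mulr0 addr0 subr_ge0.
have {xN0}x0 : 0 < x by rewrite lt_neqAle eq_sym xN0.
have := convex_expR (Itv01 (ltW b0) b1) (ln x) 0.
rewrite !convRE/= mulr0 addr0 expR0 mulr1 lnK ?posrE//.
by rewrite /powR gt_eqF// addrC.
Qed.

(** Subadditivity of the power: after division by [c ^ b], the numbers [a / c] and [(c - a) / c] lie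
    in [[0, 1]] and sum to [1], and [t <= t ^ b] on that interval. *)
Lemma powR_sub_le (R : realType) (a c b : R) :
  0 <= a <= c -> 0 < b <= 1 -> c `^ b - a `^ b <= (c - a) `^ b.
Proof.
move=> /andP[a0 ac] /andP[b0 b1].
have [c0|cN0] := eqVneq c 0.
  have -> : a = 0 by apply/eqP; rewrite eq_le a0 -c0 ac.
  by rewrite c0 subr0 powR0 ?gt_eqF// subr0.
have c0 : 0 < c by rewrite lt_neqAle eq_sym cN0 (le_trans a0).
have le_powR (x : R) : 0 <= x <= 1 -> x <= x `^ b.
  move=> /andP[]; rewrite le_eqVlt => /predU1P[<- _|x0 x1].
    exact: powR_ge0.
  by apply: ger1_powR => //; rewrite x0.
have Ha : a / c <= (a / c) `^ b.
  by apply: le_powR; rewrite divr_ge0 ?(ltW c0)//= ler_pdivrMr// mul1r.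
have Hc : (c - a) / c <= ((c - a) / c) `^ b.
  apply: le_powR; rewrite divr_ge0 ?(ltW c0) ?subr_ge0//=.
  by rewrite ler_pdivrMr// mul1r gerBl.
rewrite lerBlDr.
have -> : (c - a) `^ b = ((c - a) / c) `^ b * c `^ b.
  by rewrite -powRM ?divr_ge0 ?subr_ge0 ?(ltW c0)// divfK.
have -> : a `^ b = (a / c) `^ b * c `^ b.
  by rewrite -powRM ?divr_ge0 ?subr_ge0 ?(ltW c0)// divfK.
rewrite -mulrDl ler_peMl ?powR_ge0//; apply: le_trans (lerD Hc Ha).
by rewrite -mulrDl subrK divff.
Qed.

Section powR_integral.
Context {R : realType}.
Local Notation mu := (@lebesgue_measure R).

Lemma powR_within_continuous (r a b : R) : 0 < a ->
  {within `[a, b], continuous (fun z : R => z `^ r)}.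
Proof.
move=> a0; apply: derivable_within_continuous => x; rewrite in_itv/= => /andP[ax _].
by apply: derivable_powR; rewrite in_itv/= andbT (lt_le_trans a0).
Qed.

Lemma integral_powR_pos (b a c : R) : 0 < b -> 0 < a -> a < c ->
  (\int[mu]_(z in `[a, c]) (z `^ (b - 1))%:E = ((c `^ b - a `^ b) / b)%:E)%E.
Proof.
move=> b0 a0 ac.
have dF (x : R) : 0 < x ->
    is_derive x 1 (fun z : R => b^-1 * z `^ b) (x `^ (b - 1)).
  move=> x0.
  have := @is_deriveZ _ _ _ _ b^-1 _ _ _ (is_derive1_powR b x0).
  rewrite scalerA mulVf ?gt_eqF// scale1r.
  by apply.
have cF (x : R) : 0 < x -> {for x, continuous (fun z : R => b^-1 * z `^ b)}.
  move=> x0; apply: differentiable_continuous; apply/derivable1_diffP.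
  exact: (@ex_derive _ _ _ _ _ _ _ (dF _ x0)).
rewrite (@continuous_FTC2 _ _ (fun z : R => b^-1 * z `^ b))//.
- by rewrite -EFinB -mulrBr mulrC.
- exact: powR_within_continuous.
- split => /=.
  + move=> x; rewrite in_itv/= => /andP[ax _].
    exact: (@ex_derive _ _ _ _ _ _ _ (dF _ (lt_trans a0 ax))).
  + by apply: cvg_at_right_filter; exact: cF.
  + by apply: cvg_at_left_filter; apply: cF; exact: lt_trans ac.
- move=> x; rewrite in_itv/= => /andP[ax _].
  by rewrite derive1E (@derive_val _ _ _ _ _ _ _ (dF _ (lt_trans a0 ax))).
Qed.

(** Subadditivity makes the bound depend on the length of the interval only. The singularity at [0]
    is kept outside, so the negative case is a reflection of the positive one. *)
Lemma integral_powR_norm_le (b a c : R) : 0 < b <= 1 ->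
  a < c -> (0 < a) || (c < 0) ->
  (\int[mu]_(z in `[a, c]) (`|z| `^ (b - 1))%:E <= ((c - a) `^ b / b)%:E)%E.
Proof.
move=> /andP[b0 b1].
suff pos (x y : R) : 0 < x -> x < y ->
    (\int[mu]_(z in `[x, y]) (z `^ (b - 1))%:E <= ((y - x) `^ b / b)%:E)%E.
  move=> ac /orP[a0|c0].
    rewrite [leLHS](_ : _ = \int[mu]_(z in `[a, c]) (z `^ (b - 1))%:E)%E; first exact: pos.
    apply: eq_integral => z; rewrite inE/= in_itv/= => /andP[az _].
    by rewrite ger0_norm// ltW// (lt_le_trans a0).
  rewrite [leLHS](_ : _ =
      \int[mu]_(z in `[a, c]) (((fun t => t `^ (b - 1)) \o -%R) z)%:E)%E; last first.
    apply: eq_integral => z; rewrite inE/= in_itv/= => /andP[_ zc].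
    by rewrite /= ler0_norm// ltW// (le_lt_trans zc).
  have := @integration_by_substitution_oppr R (fun t => t `^ (b - 1)) a c (ltW ac).
  move=> <-.
    by rewrite (le_trans (pos _ _ _ _)) ?oppr_gt0 ?ltrN2// opprK addrC.
  by apply: powR_within_continuous; rewrite oppr_gt0.
move=> x0 xy; rewrite integral_powR_pos// lee_fin ler_pM2r ?invr_gt0//.
by apply: powR_sub_le; rewrite ?b0// (ltW x0) ltW.
Qed.

End powR_integral.

(** * Increments of a distribution with bounded generalized hazard rate *)

Section hazard_increment.
Context {R : realType} {d : measure_display} {Omega : measurableType d}.
Context (P : probability Omega R) (X : {RV P >-> R}) (f : R -> R).
Local Notation mu := (@lebesgue_measure R).
Hypothesis mf : measurable_fun setT f.
Hypothesis f_ge0 : forall z, 0 <= f z.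
Hypothesis Xf : has_density P X f.

Let mX (A : set R) : measurable A -> measurable (X @^-1` A).
Proof. exact: measurable_funPTI. Qed.

Lemma cdf_of_density (z : R) : (cdf_of f z)%:E = P (X @^-1` `]-oo, z]).
Proof. by rewrite /cdf_of -Xf// fineK// fin_num_measure//; exact: mX. Qed.

Lemma ccdf_of_density (z : R) : (1 - cdf_of f z)%:E = P (X @^-1` `]z, +oo[).
Proof.
rewrite EFinB cdf_of_density -probability_setC; last exact: mX.
by rewrite preimage_setC setCitvl.
Qed.

Lemma cdf_of_le (y z : R) : y <= z -> cdf_of f y <= cdf_of f z.
Proof.
move=> yz; rewrite -lee_fin !cdf_of_density le_measure ?inE//; try exact: mX.
by apply: preimage_subset => x /=; rewrite !in_itv/= => /le_trans; exact.
Qed.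

Lemma density_point0 (z : R) : P (X @^-1` [set z]) = 0%E.
Proof. by rewrite Xf// integral_set1. Qed.

Context (alpha C : R).
Hypothesis F_lt1 : forall z, cdf_of f z < 1.
Hypothesis alpha01 : 0 <= alpha < 1.
Hypothesis C_gt0 : 0 < C.
Hypothesis hazard_le : forall z, gen_hazard f alpha z <= C.
Local Notation b := (1 - alpha).
Local Notation S y := (1 - cdf_of f y).

Let b01 : 0 < b <= 1.
Proof. by case/andP: alpha01 => a0 a1; rewrite subr_gt0 a1 gerBl. Qed.
Let b0 : 0 < b. Proof. by case/andP: b01. Qed.
Let S_gt0 y : 0 < S y. Proof. by rewrite subr_gt0. Qed.

(** The hazard bound is solved for [f z], and [S z] is replaced by the larger [S y], a constant for
    the later integration. At [z = 0] the factor [|z| ^ alpha] may vanish and leave [f]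
    uncontrolled. *)
Lemma density_le_hazard (y z : R) : y <= z -> z != 0 ->
  f z <= C * S y `^ b * `|z| `^ (b - 1).
Proof.
move=> yz z0; have z_gt0 : 0 < `|z| by rewrite normr_gt0.
have -> : b - 1 = - alpha by rewrite addrAC subrr add0r.
rewrite powRN ler_pdivlMr ?powR_gt0//.
have fz : f z * `|z| `^ alpha <= C * S z `^ b.
  by rewrite -ler_pdivrMr ?powR_gt0//; exact: hazard_le.
apply: (le_trans fz); rewrite (ler_pM2l C_gt0).
apply: ge0_ler_powR; rewrite ?nnegrE.
- exact: ltW.
- exact: ltW.
- exact: ltW.
- by rewrite lerB// cdf_of_le.
Qed.

Lemma hazard_segment (y a c : R) : y <= a -> (0 < a) || (c < 0) ->
  (P (X @^-1` `[a, c]) <= (C * S y `^ b * ((c - a) `^ b / b))%:E)%E.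
Proof.
move=> ya sgn.
have f_le z : y <= z -> z != 0 -> f z <= C * S y `^ b * `|z| `^ (b - 1).
  exact: density_le_hazard.
have : 0 < C * S y `^ b by rewrite mulr_gt0// powR_gt0.
move: (C * _) f_le => M f_le M_gt0; have M_ge0 := ltW M_gt0.
have [ac|ca|<-] := ltgtP a c; last 2 first.
- by rewrite set_itv_ge ?preimage_set0 ?measure0 ?lee_fin ?bnd_simp -?ltNge//
    mulr_ge0// divr_ge0 ?powR_ge0// ltW.
- by rewrite set_itv1 density_point0 lee_fin mulr_ge0// divr_ge0 ?powR_ge0// ltW.
rewrite Xf// EFinM.
apply: (@le_trans _ _ (\int[mu]_(z in `[a, c])
    (M%:E * (`|z| `^ (b - 1))%:E))%E).
  have mg : measurable_fun `[a, c] (EFin \o (fun z : R => `|z| `^ (b - 1))).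
    apply/measurable_EFinP; apply: measurable_funTS.
    by apply: (measurableT_comp (measurable_powR _)) => //; exact: normr_measurable.
  apply: ge0_le_integral => //.
  - by move=> x _; rewrite lee_fin.
  - by apply/measurable_EFinP; apply: measurable_funTS.
  - exact: measurable_funeM.
  - move=> z /=; rewrite in_itv/= => /andP[az zc]; rewrite -EFinM lee_fin.
    apply: f_le; first exact: le_trans az.
    case/orP: sgn => [a0|c0]; first by rewrite gt_eqF// (lt_le_trans a0).
    by rewrite lt_eqF// (le_lt_trans zc).
rewrite ge0_integralZl_EFin//.
- by rewrite lee_pmul2l ?lte_fin//; exact: integral_powR_norm_le.
- apply/measurable_EFinP; apply: measurable_funTS.
  by apply: (measurableT_comp (measurable_powR _)) => //; exact: normr_measurable.
Qed.

Lemma hazard_increment (y u : R) : 0 <= u ->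
  (P (X @^-1` `]y, (y + u)%R]) <= (2 * C / b * u `^ b * S y `^ b)%:E)%E.
Proof.
move=> u0; have := hazard_segment y.
have : 0 < C * S y `^ b by rewrite mulr_gt0// powR_gt0.
have -> : 2 * C / b * u `^ b * S y `^ b = C * S y `^ b * (u `^ b / b) *+ 2.
  by rewrite -mulr_natr; field; exact: lt0r_neq0.
move: (C * _) => M M_gt0 segment; set K := (X in (_ <= X)%E).
(* The density is not controlled at 0, so 0 is approached from both sides;
   hence the factor 2. *)
pose e (n : nat) : R := n.+1%:R^-1.
have e0 n : 0 < e n by rewrite invr_gt0.
pose A n := X @^-1` (`]y, (y + u)%R] `&` (`]-oo, (- e n)%R] `|` `[e n, +oo[)).
have mA n : measurable (A n).
  by apply: mX => //; apply: measurableI => //; exact: measurableU.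
have AK n : (P (A n) <= K)%E.
  have powR_len (a c : R) : y <= a -> c <= y + u -> (c - a) `^ b <= u `^ b \/ c < a.
    move=> ya cyu; case: (ltP c a) => ca; [by right|left].
    by apply: ge0_ler_powR; rewrite ?(ltW b0) ?nnegrE ?subr_ge0//; lra.
  have piece (a c : R) : y <= a -> c <= y + u -> (0 < a) || (c < 0) ->
      (P (X @^-1` `[a, c]) <= (M * (u `^ b / b))%:E)%E.
    move=> ya cyu sgn; have [len|ca] := powR_len a c ya cyu.
      rewrite (le_trans (segment _ _ ya sgn))// lee_fin.
      by rewrite ler_pM2l// ler_pM2r// invr_gt0.
    rewrite set_itv_ge ?preimage_set0 ?measure0 ?lee_fin ?bnd_simp -?ltNge//.
    by rewrite mulr_ge0 ?divr_ge0 ?powR_ge0// ltW.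
  (* One closed interval on each side of [0], each of length at most [u] and possibly empty; [piece]
     covers both cases. *)
  have AU : A n `<=` X @^-1` `[y, (Num.min (- e n) (y + u))%R] `|`
                     X @^-1` `[(Num.max y (e n))%R, (y + u)%R].
    move=> w; rewrite /A /= !in_itv/= => -[/andP[yX Xyu] [Xe|]].
      by left; rewrite (ltW yX) le_min Xe.
    by rewrite andbT => eX; right; rewrite ge_max (ltW yX) eX.
  rewrite (le_trans (le_measure P _ _ AU)) ?inE//.
    by apply: measurableU; exact: mX.
  rewrite (le_trans (measureU2 _ _ _))//; try exact: mX.
  rewrite (_ : K = (M * (u `^ b / b))%:E + (M * (u `^ b / b))%:E)%E.
    apply: leeD; apply: piece => //.
    - by rewrite ge_min lexx orbT.
    - by rewrite gt_min oppr_lt0 e0 orbT.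
    - by rewrite le_max lexx.
    - by rewrite lt_max e0 orbT.
  by rewrite /K -EFinD mulr2n.
have UA : \bigcup_n A n = X @^-1` (`]y, (y + u)%R] `\ 0).
  apply/seteqP; split => w.
    move=> [n _]; rewrite /A/= !in_itv/= => -[-> H]; split => // X0.
    have := e0 n; case: H; rewrite ?andbT X0; [rewrite lerNr oppr0|];
      by rewrite leNgt => /negP.
  rewrite /= => -[yX X0]; have X0' : 0 < `|X w| by rewrite normr_gt0; apply/eqP.
  have [n ltn] := ltr_add_invr X0'; exists n => //; split => //=.
  rewrite add0r in ltn; rewrite !in_itv/= andbT.
  by apply/orP; rewrite lerNr orbC -ler_normr ltW.
(* The bound [K] does not depend on [n], so it passes to the union by continuity from below; the
   missing point [0] has mass zero. *)
have cvgA : (P \o A) n @[n --> \oo] --> P (\bigcup_n A n).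
  apply: nondecreasing_cvg_mu => //; first exact: bigcupT_measurable.
  move=> m n mn; apply/subsetPset => w.
  rewrite /A/= !in_itv/= !andbT => -[-> H]; split => //.
  have enm : e n <= e m by rewrite lef_pV2 ?posrE// ler_nat.
  by case: H => H; [left|right]; rewrite ?(le_trans H) ?lerN2 ?(le_trans enm).
have lek : (P (\bigcup_n A n) <= K)%E.
  rewrite -(cvg_lim (@ereal_hausdorff _) cvgA); apply: lime_le; last exact: nearW.
  by apply/cvg_ex; exists (P (\bigcup_n A n)).
rewrite (le_trans _ lek)// UA.
have sub : X @^-1` `]y, (y + u)%R] `<=`
    X @^-1` (`]y, (y + u)%R] `\ 0) `|` X @^-1` [set 0].
  by move=> w /= yX; have [->|/eqP] := eqVneq (X w) 0; [right|left].
rewrite (le_trans (le_measure P _ _ sub)) ?inE//; try exact: mX.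
  by apply: measurableU; apply: mX => //; exact: measurableD.
rewrite (le_trans (measureU2 _ _ _))//; try (apply: mX => //; exact: measurableD).
by rewrite [X in (_ + X)%E](_ : _ = 0%E) ?adde0//; exact: density_point0.
Qed.

End hazard_increment.

(** * Independence *)

Section independence.
Context {R : realType} {d : measure_display} {Omega : measurableType d}.
Variable P : probability Omega R.

(** Open rays form a generating pi-system that exhausts the line. They suit maxima: a maximum is
    below [y] exactly when each of its terms is. *)
Lemma measure_eq_open_rays (m1 m2 : {measure set R -> \bar R}) :
  (forall y : R, m1 `]-oo, y[%classic = m2 `]-oo, y[%classic) ->
  (forall y : R, (m1 `]-oo, y[%classic < +oo)%E) ->
  forall A : set R, measurable A -> m1 A = m2 A.
Proof.
move=> m12 m1oo A mA.
apply: (measure_unique (@RGenInftyO.G R) (fun n : nat => `]-oo, n%:R[%classic)) => //.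
- exact: RGenInftyO.measurableE.
- move=> _ _ [x ->] [y ->]; exists (Num.min x y).
  by apply/seteqP; split => z /=; rewrite !in_itv/= lt_min => /andP.
- by move=> n; exists n%:R.
- apply/seteqP; split => // x _.
  exists (Num.trunc `|x|).+1 => //=; rewrite in_itv/=.
  by rewrite (le_lt_trans (ler_norm _))// truncnS_gt.
- by move=> _ [y ->].
Qed.

Definition independent_pair (X Y : Omega -> R) := forall A B : set R,
  measurable A -> measurable B ->
  P (X @^-1` A `&` Y @^-1` B) = (P (X @^-1` A) * P (Y @^-1` B))%E.

Lemma independent_pair_rays (X Y : {RV P >-> R}) :
  (forall (A : set R) (y : R), measurable A ->
    P (X @^-1` A `&` Y @^-1` `]-oo, y[) =
    (P (X @^-1` A) * P (Y @^-1` `]-oo, y[))%E) ->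
  independent_pair X Y.
Proof.
move=> XY A B mA mB; have mXA : measurable (X @^-1` A) by exact: measurable_funPTI.
have PXA : P (X @^-1` A) \is a fin_num by rewrite fin_num_measure.
pose r : {nonneg R} := NngNum (fine_ge0 (measure_ge0 P (X @^-1` A))).
have mY : measurable_fun setT Y by exact: measurable_funPT.
pose m1_ : {measure set R -> \bar R} := pushforward (mrestr P mXA) Y.
pose m1 := m1_ mY.
pose m2 : {measure set R -> \bar R} := mscale r (distribution P Y).
have m1E C : m1 C = P (X @^-1` A `&` Y @^-1` C).
  by rewrite /m1 /m1_/= /pushforward /mrestr setIC.
have m2E C : m2 C = (P (X @^-1` A) * P (Y @^-1` C))%E.
  by rewrite /m2/= /mscale/= fineK.
rewrite -m1E -m2E; apply: measure_eq_open_rays => // y.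
  by rewrite m1E m2E XY.
rewrite m1E ltey_eq fin_num_measure//; apply: measurableI => //.
exact: measurable_funPTI.
Qed.

(** The joint law is the product of the marginals, by uniqueness of the product measure. [Y] comes
    first because the sections are taken at a fixed value of [Y], which amounts to conditioning on
    it. *)
Lemma independent_pair_integral (X Y : {RV P >-> R}) (E : set (R * R)) :
  independent_pair X Y -> measurable E ->
  P [set w | E (Y w, X w)] = (\int[distribution P Y]_y P (X @^-1` xsection E y))%E.
Proof.
move=> XY mE.
have mZ : measurable_fun setT (fun w => (Y w, X w)).
  by apply: measurable_fun_pair; exact: measurable_funPT.
pose Z : {mfun Omega >-> (R * R)%type} :=
  HB.pack (fun w => (Y w, X w)) (isMeasurableFun.Build _ _ _ _ _ mZ).
have := @product_measure_unique _ _ R R R (distribution P Y) (distribution P X)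
  (distribution P Z) _ E mE.
have <- : distribution P Z E = P [set w | E (Y w, X w)] by [].
move=> <- //; move=> A B mA mB; rewrite /distribution /pushforward muleC -XY//.
by congr (P _); apply/seteqP; split => w [].
Qed.

End independence.

Arguments independent_pair {R d Omega} P X Y.

(** * Comparison events and conditioning on an independent threshold *)

Section comparison_sets.
Context {R : realType} {d : measure_display} {T : measurableType d}.
Variables f g : T -> R.
Hypotheses (mf : measurable_fun setT f) (mg : measurable_fun setT g).

Lemma measurable_set_lt : measurable [set x | f x < g x].
Proof.
have /(_ measurableT [set true] I) := measurable_fun_ltr mf mg.
by rewrite setTI.
Qed.

Lemma measurable_set_le : measurable [set x | f x <= g x].
Proof.
have /(_ measurableT [set true] I) := measurable_fun_ler mf mg.
by rewrite setTI.
Qed.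

Lemma measurable_set_eq : measurable [set x | f x = g x].
Proof.
have /(_ measurableT [set true] I) := measurable_fun_eqr mf mg.
by rewrite setTI; congr (measurable _); apply/seteqP; split => x /eqP.
Qed.

End comparison_sets.

Section independent_comparison.
Context {R : realType} {d : measure_display} {Omega : measurableType d}.
Variables (P : probability Omega R) (X Y : {RV P >-> R}).
Hypothesis XY : independent_pair P X Y.

Let mfst : measurable_fun setT (@fst R R). Proof. exact: measurable_fst. Qed.
Let msnd : measurable_fun setT (@snd R R). Proof. exact: measurable_snd. Qed.

(** The hypothesis is the bound conditional on [Y = y]. Being affine in the conditional probability
    of winning, it survives integration over the law of [Y], which has mass one. *)
Lemma independent_increment_le (u a c : R) : 0 <= a -> 0 <= c ->
  (forall y : R, (P (X @^-1` `]y, (y + u)%R]) <=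
                  a%:E * P (X @^-1` `]y, +oo[) + c%:E)%E) ->
  (P [set w | (Y w < X w <= Y w + u)%R] <= a%:E * P [set w | (Y w < X w)%R] + c%:E)%E.
Proof.
move=> a0 c0 H.
pose E1 := [set z : R * R | z.1 < z.2] `&` [set z | z.2 <= z.1 + u].
pose E2 := [set z : R * R | z.1 < z.2].
have mE2 : measurable E2 by exact: measurable_set_lt.
have mE1 : measurable E1.
  apply: measurableI => //; apply: measurable_set_le => //.
  exact: measurable_funD.
have sec1 y : xsection E1 y = `]y, (y + u)%R]%classic.
  apply/seteqP; split => x; rewrite /xsection /E1 /= in_itv/= inE/=.
    by move=> [-> ->].
  by move=> /andP.
have sec2 y : xsection E2 y = `]y, +oo[%classic.
  by apply/seteqP; split => x; rewrite /xsection /E2 /= in_itv/= inE/= andbT.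
have -> : [set w | Y w < X w <= Y w + u] = [set w | E1 (Y w, X w)].
  by apply/seteqP; split => w /=; rewrite /E1/=; [move/andP|move/andP].
rewrite (independent_pair_integral _ _ _ _ XY mE1).
have -> : [set w | Y w < X w] = [set w | E2 (Y w, X w)] by [].
rewrite (independent_pair_integral _ _ _ _ XY mE2).
have mP (E : set (R * R)) : measurable E ->
    measurable_fun setT (fun y => P (X @^-1` xsection E y)).
  by move=> mE; exact: (measurable_fun_xsection (distribution P X)).
rewrite -ge0_integralZl_EFin//; last exact: mP.
rewrite -[X in (_ <= _ + X)%E]mule1 -(@probability_setT _ _ _ (distribution P Y)).
rewrite -integral_cst// -ge0_integralD//; last 2 first.
- by move=> y _; exact: mule_ge0.
- by apply: measurable_funeM; exact: mP.
apply: ge0_le_integral => //.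
- exact: mP.
- apply: emeasurable_funD => //.
  by apply: measurable_funeM; exact: mP.
- by move=> y _; rewrite sec1 sec2; exact: H.
Qed.

(** Once [Y] is fixed, [X] has to hit a single point. *)
Lemma independent_tie0 (c : R) : (forall x, P (X @^-1` [set x]) = 0%E) ->
  P [set w | X w = Y w + c] = 0%E.
Proof.
move=> X0; pose E := [set z : R * R | z.2 = z.1 + c].
have mE : measurable E.
  by apply: measurable_set_eq => //; exact: measurable_funD.
rewrite [LHS](independent_pair_integral _ _ _ _ XY mE).
apply: integral0_eq => y _.
suff -> : xsection E y = [set y + c] by exact: X0.
by apply/seteqP; split => x; rewrite /xsection /E /= inE.
Qed.

End independent_comparison.

Section bigmax_measurable.
Context {R : realType} {d : measure_display} {T : measurableType d}.

Lemma measurable_bigmax (I : Type) (r : seq I) (Q : pred I) (x0 : T -> R)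
    (F : I -> T -> R) :
  measurable_fun setT x0 -> (forall i, measurable_fun setT (F i)) ->
  measurable_fun setT (fun w => \big[Num.max/x0 w]_(i <- r | Q i) F i w).
Proof.
move=> mx0 mF; elim: r => [|i r IH].
  by under eq_fun do rewrite big_nil.
under eq_fun do rewrite big_cons.
by case: (Q i) => //; exact: measurable_maxr.
Qed.

End bigmax_measurable.

Section mutual_independence.
Context {R : realType} {d : measure_display} {Omega : measurableType d}.
Context (P : probability Omega R) (N : nat) (X : 'I_N -> {RV P >-> R}).
Hypothesis indX : mutually_independent P (fun i => X i : Omega -> R).

Lemma mutually_independent_pair (i j : 'I_N) : i != j ->
  independent_pair P (X i) (X j).
Proof.
move=> ij A B mA mB.
have := indX [set i; j]%SET (fun k => if k == i then A else B).
rewrite big_setU1 ?finset.in_set1//= big_set1 eqxx.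
rewrite (negbTE (_ : j != i)) 1?eq_sym//= => <-; last first.
  by move=> k; case: ifP.
congr (P _); apply/seteqP; split => w /=.
  by move=> [wA wB] k /=; rewrite in_set2; case: ifPn => [/eqP -> //|_ /= /eqP ->].
move=> H; split.
  by have := H i; rewrite /= in_set2 eqxx; exact.
by have := H j; rewrite /= in_set2 eqxx orbT (negbTE (_ : j != i)) 1?eq_sym//; exact.
Qed.

(** [Y < y] is a conjunction of conditions on the [X j] with [j != i]. The factorisation [prodB],
    taken for [A] and for the whole line, yields the same product over those [j]. *)
Lemma mutually_independent_max (i : 'I_N) (c : 'I_N -> R) (Y : {RV P >-> R}) :
  (forall w y, Y w < y <-> forall j, j != i -> c j + X j w < y) ->
  independent_pair P (X i) Y.
Proof.
move=> YP; apply: independent_pair_rays => A y mA.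
pose B (A' : set R) (j : 'I_N) : set R :=
  if j == i then A' else `]-oo, (y - c j)%R[%classic.
have mB A' : measurable A' -> forall j, measurable (B A' j).
  by move=> mA' j; rewrite /B; case: ifP.
have prodB A' : measurable A' -> P (X i @^-1` A' `&` Y @^-1` `]-oo, y[) =
    (P (X i @^-1` A') * \prod_(j in [set~ i]%SET) P (X j @^-1` `]-oo, (y - c j)%R[))%E.
  move=> mA'; have := indX [set: 'I_N]%SET (B A') (mB _ mA').
  rewrite (bigD1 i) ?finset.in_setT//= => H.
  rewrite (_ : X i @^-1` A' `&` _ =
    \bigcap_(j in [set j | j \in [set: 'I_N]%SET]) X j @^-1` B A' j).
    rewrite H; congr (_ * _)%E; first by rewrite /B eqxx.
    apply: eq_big => [j|j /andP[_ /negbTE ji]].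
      by rewrite finset.in_setT in_setC1.
    by rewrite /B ji.
  apply/seteqP; split => w /=.
    rewrite in_itv/= => -[wA' /YP Yw] j _ /=; rewrite /B; case: ifPn => [/eqP -> //|ji].
    by rewrite /= in_itv/= ltrBrDl; exact: Yw.
  rewrite in_itv/= => H'; split.
    by have := H' i; rewrite /= finset.in_setT /B eqxx; exact.
  apply/YP => j ji; have := H' j; rewrite /= finset.in_setT /B (negbTE ji) => /(_ isT).
  by rewrite /= in_itv/= ltrBrDl.
have -> : Y @^-1` `]-oo, y[ = X i @^-1` setT `&` Y @^-1` `]-oo, y[.
  by rewrite preimage_setT setTI.
rewrite prodB// preimage_setT probability_setT mul1e setTI.
exact: prodB.
Qed.

End mutual_independence.

(** * Gradient and potential *)

Section smooth_gradient.
Context {R : realType} {d : measure_display} {Omega : measurableType d}.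
Context (P : probability Omega R) (N : nat) (X : 'I_N -> {RV P >-> R}).
Context (f : R -> R) (eta : R).
Hypothesis mf : measurable_fun setT f.
Hypothesis f_ge0 : forall z, 0 <= f z.
Hypothesis indX : mutually_independent P (fun i => X i : Omega -> R).
Hypothesis Xf : forall i, has_density P (X i) f.
Hypothesis eta_gt0 : 0 < eta.
Local Notation W i w := (eta * X i w).
Local Notation grad := (smooth_grad P (fun i => X i : Omega -> R) eta).

Definition argmax_event (G : 'I_N -> R) (i : 'I_N) : set Omega :=
  [set w | forall j, j != i -> G j + W j w < G i + W i w].

Let mX i : measurable_fun setT (X i). Proof. exact: measurable_funPT. Qed.

Lemma measurable_perturbed (c : R) (i : 'I_N) :
  measurable_fun setT (fun w => c + W i w).
Proof. by apply: measurable_funD => //; apply: measurable_funM. Qed.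

Lemma measurable_argmax_event G i : measurable (argmax_event G i).
Proof.
rewrite (_ : argmax_event G i =
    \bigcap_(j in [set j | j != i]) [set w | G j + W j w < G i + W i w]).
  apply: fin_bigcap_measurable => [|j _]; first exact: finite_finset.
  by apply: measurable_set_lt; exact: measurable_perturbed.
by apply/seteqP; split => w.
Qed.

Lemma smooth_gradE G i : (grad G i)%:E = P (argmax_event G i).
Proof.
rewrite /smooth_grad fineK// fin_num_measure//; exact: measurable_argmax_event.
Qed.

Lemma smooth_grad_ge0 G i : 0 <= grad G i.
Proof. by rewrite fine_ge0. Qed.

Lemma perturbed_tie0 (G : 'I_N -> R) (i j : 'I_N) : i != j ->
  P [set w | G i + W i w = G j + W j w] = 0%E.
Proof.
move=> ij; have indXij := mutually_independent_pair _ _ _ indX _ _ ij.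
have X0 x : P (X i @^-1` [set x]) = 0%E by exact: (density_point0 _ _ _ (Xf i)).
rewrite -(independent_tie0 _ _ _ indXij ((G j - G i) / eta) X0).
congr (P _); apply/seteqP; split => w /= H.
  apply: (mulfI (lt0r_neq0 eta_gt0)); rewrite mulrDr [eta * (_ / _)]mulrC divfK ?gt_eqF//.
  by apply: (addrI (G i)); rewrite H; ring.
by rewrite H; field; exact: lt0r_neq0.
Qed.

(** Strict inequalities make the argmax events disjoint. Outside their union some maximiser is tied
    with another arm, and ties are null because the perturbations are independent and atomless. *)
Lemma sum_smooth_grad (G : 'I_N -> R) : (0 < N)%N -> \sum_i grad G i = 1.
Proof.
move=> N0; pose U := \bigcup_(i in [set` enum 'I_N]) argmax_event G i.
have mU : measurable U.
  apply: fin_bigcup_measurable => [|i _]; first exact: finite_finset.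
  exact: measurable_argmax_event.
pose tie (ij : 'I_N * 'I_N) :=
  [set w | ij.1 != ij.2 /\ G ij.1 + W ij.1 w = G ij.2 + W ij.2 w].
have tieE ij : tie ij = set0 \/
    ij.1 != ij.2 /\ tie ij = [set w | G ij.1 + W ij.1 w = G ij.2 + W ij.2 w].
  have [e|ne] := eqVneq ij.1 ij.2.
    by left; apply/seteqP; split => // w []; rewrite e eqxx.
  by right; split => //; apply/seteqP; split => w //= [].
have mtie ij : measurable (tie ij).
  have [->//|[_ ->]] := tieE ij.
  by apply: measurable_set_eq; exact: measurable_perturbed.
have tie0 ij : P (tie ij) = 0%E.
  by have [->|[ne ->]] := tieE ij; [rewrite measure0|exact: perturbed_tie0].
pose V := \big[setU/set0]_(ij <- enum {: 'I_N * 'I_N}) tie ij.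
have [mV PV] : measurable V /\ P V = 0%E.
  rewrite /V; elim: (enum _) => [|ij r [mr Pr]].
    by rewrite big_nil measure0.
  rewrite big_cons; split; first exact: measurableU.
  by rewrite measureU0; [exact: tie0|exact: mtie|exact: mr|exact: Pr].
have UV : ~` U `<=` V.
  move=> w wU; rewrite /V -bigcup_seq.
  pose v i := G i + W i w.
  case: (@arg_maxP _ _ _ (Ordinal N0) xpredT v isT) => i _ imax.
  have /existsNP[j /not_implyP[ji /negP]] : ~ argmax_event G i w.
    by move=> wi; apply: wU; exists i => //=; rewrite mem_enum.
  rewrite -leNgt => le_ij; exists (i, j) => /=; first by rewrite mem_enum.
  split; first by rewrite eq_sym.
  by apply/eqP; rewrite eq_le le_ij; exact: imax.
have PU : P U = 1%E.
  rewrite -[U]setCK probability_setC; last exact: measurableC.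
  rewrite (_ : P (~` U) = 0%E) ?sube0//.
  by apply/eqP; rewrite eq_le measure_ge0 andbT -PV le_measure ?inE//; exact: measurableC.
apply: EFin_inj; rewrite -sumEFin -PU /U measure_fin_bigcup//.
- rewrite -fsbig_seq ?enum_uniq// big_enum/=.
  by apply: eq_bigr => i _; rewrite smooth_gradE.
- move=> i j _ _ [w [/= wi wj]]; apply/eqP; apply: contraT => ij.
  have := lt_trans (wi j _) (wj i ij); rewrite eq_sym ltxx => /(_ ij).
  by [].
- by move=> i _; exact: measurable_argmax_event.
Qed.

Context (alpha C : R).
Hypothesis F_lt1 : forall z, cdf_of f z < 1.
Hypothesis alpha01 : 0 <= alpha < 1.
Hypothesis C_gt0 : 0 < C.
Hypothesis hazard_le : forall z, gen_hazard f alpha z <= C.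
Local Notation b := (1 - alpha).

(** Only the estimate of arm [i] moves, so one threshold [Y] serves before and after: the winning
    condition [Y < X i] becomes [Y + s / eta < X i], and the loss is the mass of an increment above
    [Y]. *)
Lemma smooth_grad_shift_le (G : 'I_N -> R) (i : 'I_N) (s : R) :
  0 <= s -> 0 < grad G i ->
  grad G i - grad (fun j => G j + (if j == i then - s else 0)) i <=
  2 * C / b * (s / eta) `^ b * grad G i `^ b.
Proof.
move=> s0 p_gt0; set G' := (X in _ - grad X i); set p := grad G i in p_gt0 *.
have b01 : 0 < b <= 1 by case/andP: alpha01 => a0 a1; rewrite subr_gt0 a1 gerBl.
have b0 : 0 < b by case/andP: b01.
set K := 2 * C / b * _; have K0 : 0 <= K.
  by rewrite mulr_ge0 ?powR_ge0// divr_ge0 ?(ltW b0)// mulr_ge0// ltW.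
have G'i : G' i = G i - s by rewrite /G' eqxx.
have G'j j : j != i -> G' j = G j by move=> /negbTE ji; rewrite /G' ji addr0.
(* A single arm has no competitor: it wins with probability one before and after. *)
have [j0 ji0|no_j] := pickP (fun j : 'I_N => j != i); last first.
  have full H : argmax_event H i = setT.
    by apply/seteqP; split => // w _ j ji; have := no_j j; rewrite ji.
  have -> : p = grad G' i by apply: EFin_inj; rewrite !smooth_gradE !full.
  by rewrite subrr mulr_ge0// powR_ge0.
pose c j := (G j - G i) / eta.
have etac j : eta * c j = G j - G i by rewrite mulrC divfK// gt_eqF.
have etau : eta * (s / eta) = s by rewrite mulrC divfK// gt_eqF.
(* The default value is the term of [j0], itself in the range, so it leaves the maximum
   unchanged. *)
pose Y0 w := \big[Num.max/c j0 + X j0 w]_(j | j != i) (c j + X j w).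
have mY0 : measurable_fun setT Y0.
  by apply: measurable_bigmax => [|j]; apply: measurable_funD.
pose Y : {RV P >-> R} := HB.pack Y0 (isMeasurableFun.Build _ _ _ _ _ mY0).
have YP w y : Y w < y <-> forall j, j != i -> c j + X j w < y.
  split; first by move=> /bigmax_ltP[].
  by move=> H; apply/bigmax_ltP; split => //; exact: H.
have indXY := mutually_independent_max _ _ _ indX _ _ _ YP.
have AG : argmax_event G i = [set w | Y w < X i w].
  apply/seteqP; split => w /=.
    move=> H; apply/YP => j /H H'; rewrite -(ltr_pM2l eta_gt0) mulrDr etac.
    by lra.
  move=> /YP H j /H; rewrite -(ltr_pM2l eta_gt0) mulrDr etac.
  by move=> H'; lra.
have AG' : argmax_event G' i = [set w | Y w + s / eta < X i w].
  apply/seteqP; split => w /=.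
    move=> H; rewrite -ltrBrDr; apply/YP => j ji; have := H j ji; rewrite G'i G'j// => H'.
    rewrite ltrBrDr -(ltr_pM2l eta_gt0) !mulrDr etac etau.
    by lra.
  rewrite -ltrBrDr => /YP H j ji; have := H j ji; rewrite G'i G'j//.
  rewrite ltrBrDr -(ltr_pM2l eta_gt0) !mulrDr etac etau.
  by move=> H'; lra.
have u0 : 0 <= s / eta by rewrite divr_ge0// ltW.
pose inc := [set w | Y w < X i w <= Y w + s / eta].
have mY : measurable_fun setT Y by exact: measurable_funPT.
have minc : measurable inc.
  rewrite (_ : inc = [set w | Y w < X i w] `&` [set w | X i w <= Y w + s / eta]).
    apply: measurableI; first exact: measurable_set_lt.
    by apply: measurable_set_le => //; exact: measurable_funD.
  by apply/seteqP; split => w /andP.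
(* Jensen's inequality as the tangent line of [x^b] at [p], which keeps the
   bound affine in the conditional winning probability. *)
have inc_le : (P inc <= (K * p `^ b * b / p)%:E * P (argmax_event G i) +
    (K * p `^ b * (1 - b))%:E)%E.
  rewrite AG; apply: (independent_increment_le _ _ _ indXY).
  - by rewrite divr_ge0 ?(ltW p_gt0)// mulr_ge0 ?(ltW b0)// mulr_ge0// powR_ge0.
  - by apply: mulr_ge0; [rewrite mulr_ge0 ?powR_ge0|case/andP: b01; rewrite subr_ge0].
  move=> y; apply: (le_trans (hazard_increment _ _ _ mf f_ge0 (Xf i) _ _
    F_lt1 alpha01 C_gt0 hazard_le _ _ u0)).
  rewrite -(ccdf_of_density _ _ _ (Xf i)) -EFinM -EFinD lee_fin.
  have : 0 <= 1 - cdf_of f y by rewrite subr_ge0 ltW.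
  move: (1 - cdf_of f y) => S S0; rewrite -/K.
  have Sp0 : 0 <= S / p by rewrite divr_ge0// ltW.
  have -> : S `^ b = p `^ b * (S / p) `^ b.
    by rewrite -powRM ?(ltW p_gt0)// mulrC divfK ?gt_eqF.
  rewrite mulrA [leRHS](_ : _ = K * p `^ b * (1 - b + b * (S / p))); last first.
    by field; exact: lt0r_neq0.
  apply: ler_wpM2l; first by apply: mulr_ge0 => //; exact: powR_ge0.
  exact: powR_le_affine.
have cover : argmax_event G i `<=` argmax_event G' i `|` inc.
  rewrite AG AG' => w /= YX; case: (ltP (Y w + s / eta) (X i w)) => H; [by left|right].
  by rewrite /inc/= YX H.
have mG' := measurable_argmax_event G' i.
have H : (P (argmax_event G i) <= P (argmax_event G' i) + P inc)%E.
  apply: le_trans (measureU2 _ mG' minc); apply: le_measure; rewrite ?inE//.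
    exact: measurable_argmax_event.
  exact: measurableU.
have {H} := le_trans H (leeD2l _ inc_le); rewrite -!smooth_gradE -/p.
rewrite -EFinM -!EFinD lee_fin => H; rewrite lerBlDl; apply: (le_trans H).
(* The argmax event has probability [p], the point of tangency, so the affine bound collapses to
   [K * p ^ b]. *)
rewrite lerD2l [leLHS](_ : _ = K * p `^ b)//.
by field; exact: lt0r_neq0.
Qed.

End smooth_gradient.

(** * Finite maxima and their integrability *)

Section maxI_theory.
Context {R : realType} (N : nat).
Hypothesis N_gt0 : (0 < N)%N.
Implicit Types v : 'I_N -> R.

(** The index [i0] is chosen before [v], so the default value becomes a measurable function when [v]
    depends on the outcome. *)
Lemma maxI_bigmax : exists i0 : 'I_N, forall v,
  maxI v = \big[Num.max/v i0]_(i < N) v i.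
Proof.
have : Ordinal N_gt0 \in enum 'I_N by rewrite mem_enum.
rewrite /maxI; case: (enum 'I_N) => // i0 s _.
by exists i0 => v.
Qed.

Lemma le_maxI v i : v i <= maxI v.
Proof. exact: le_bigmax. Qed.

Lemma maxI_le v m : (forall i, v i <= m) -> maxI v <= m.
Proof. by move=> vm; have [i0 ->] := maxI_bigmax; apply/bigmax_leP. Qed.

Lemma maxI_eq v : exists i, maxI v = v i.
Proof.
case: (@arg_maxP _ _ _ (Ordinal N_gt0) xpredT v isT) => i _ imax.
by exists i; apply/le_anti; rewrite le_maxI maxI_le// => j; exact: imax.
Qed.

Lemma integrable_maxI d (T : measurableType d) (mu : {measure set T -> \bar R})
    (F : 'I_N -> T -> R) :
  (forall i, mu.-integrable setT (EFin \o F i)) ->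
  mu.-integrable setT (EFin \o (fun w => maxI (fun i => F i w))).
Proof.
move=> intF.
have mF i : measurable_fun setT (F i).
  by have /integrableP[/measurable_EFinP] := intF i.
apply: (@le_integrable _ _ _ mu setT measurableT _
    (fun w => (\sum_i `|(F i w)%:E|)%E)).
- apply/measurable_EFinP; have [i0 maxE] := maxI_bigmax.
  by under eq_fun do rewrite maxE; exact: measurable_bigmax.
- move=> w _; rewrite (@gee0_abs _ (\sum_i _)%E); last by apply: sume_ge0 => i _.
  have [i /= ->] := maxI_eq (fun i => F i w).
  by rewrite (bigD1 i)//= leeDl// sume_ge0.
- by apply: integrable_sum => // i _; exact: integrable_abse (intF i).
Qed.

End maxI_theory.

(** * From an integrable density to integrable perturbations *)

Section density_integrable.
Context {R : realType} {d : measure_display} {Omega : measurableType d}.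
Context (P : probability Omega R) (X : {RV P >-> R}) (f : R -> R).
Local Notation mu := (@lebesgue_measure R).

(** The law of [X] is dominated by Lebesgue measure and its Radon-Nikodym derivative is [f] almost
    everywhere; a change of variables turns the mean of [|X|] into the integral of [|z f z|]. *)
Lemma density_integrable : measurable_fun setT f -> (forall z, 0 <= f z) ->
  has_density P X f -> mu.-integrable setT (fun z => (z * f z)%:E) ->
  P.-integrable setT (EFin \o X).
Proof.
move=> mf f_ge0 Xf intf.
have mX : measurable_fun setT X by exact: measurable_funPT.
apply/integrableP; split; first exact/measurable_EFinP.
have mabs : measurable_fun setT (fun z : R => `|z%:E|%E).
  by apply: measurableT_comp => //; exact/measurable_EFinP.
have mX' : @measurable_fun _ _ Omega (measurableTypeR R) setT X by exact: mX.
pose X' : {mfun Omega >-> measurableTypeR R} := HB.pack (X : Omega -> measurableTypeR R)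
  (isMeasurableFun.Build _ _ Omega (measurableTypeR R) _ mX').
pose nu : {finite_measure set (measurableTypeR R) -> \bar R} := distribution P X'.
have -> : (\int[P]_w `|(EFin \o X) w| = \int[nu]_z `|z%:E|)%E.
  by rewrite /nu/= ge0_integral_distribution.
have dom : nu `<< mu.
  apply/null_content_dominatesP => A mA A0.
  rewrite /nu/= /distribution /pushforward Xf// null_set_integral//.
  by apply/measurable_EFinP; exact: measurable_funTS.
rewrite -(Radon_Nikodym_SigmaFinite.change_of_variables dom)//.
have RNf : ae_eq mu setT (Radon_Nikodym_SigmaFinite.f nu mu) (EFin \o f).
  apply: integral_ae_eq => //.
  - exact: Radon_Nikodym_SigmaFinite.f_integrable.
  - exact/measurable_EFinP.
  - by move=> E _ mE; rewrite -Radon_Nikodym_SigmaFinite.f_integral//= -Xf.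
rewrite [ltLHS](_ : _ = \int[mu]_z `|(z * f z)%:E|)%E.
  by have /integrableP[] := intf.
apply: ae_eq_integral => //.
- apply: emeasurable_funM => //.
  exact: measurable_int (Radon_Nikodym_SigmaFinite.f_integrable dom).
- by apply: measurableT_comp => //; have /integrableP[] := intf.
- apply: filterS RNf => z RNz _; rewrite RNz//= -EFinM normrM.
  by rewrite (ger0_norm (f_ge0 z)).
Qed.

End density_integrable.

(** * The smoothed potential and its convexity *)

Section potential.
Context {R : realType} {d : measure_display} {Omega : measurableType d}.
Context (P : probability Omega R) (N : nat) (X : 'I_N -> {RV P >-> R}) (eta : R).
Hypothesis N_gt0 : (0 < N)%N.
Hypothesis intX : forall i, P.-integrable setT (EFin \o X i).
Local Notation grad := (smooth_grad P (fun i => X i : Omega -> R) eta).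

Definition smooth_potential (G : 'I_N -> R) : R :=
  \int[P]_w maxI (fun j => G j + eta * X j w).

Lemma integrable_perturbed (c : R) (i : 'I_N) :
  P.-integrable setT (EFin \o (fun w => c + eta * X i w)).
Proof.
rewrite (_ : EFin \o _ = (EFin \o cst c) \+ (fun w => eta%:E * (EFin \o X i) w))%E.
  by apply: integrableD => //; [exact: finite_measure_integrable_cst|exact: integrableZl].
by apply/funext => w /=; rewrite EFinD EFinM.
Qed.

Lemma integrable_perturbed_max (G : 'I_N -> R) :
  P.-integrable setT (EFin \o (fun w => maxI (fun j => G j + eta * X j w))).
Proof. by apply: integrable_maxI => // i; exact: integrable_perturbed. Qed.

Lemma le_smooth_potential (G : 'I_N -> R) (i : 'I_N) :
  G i + eta * (\int[P]_w X i w) <= smooth_potential G.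
Proof.
rewrite -RintegralZl// -[G i]mulr1.
have -> : 1 = fine (P setT) by rewrite probability_setT.
rewrite -Rintegral_cst// -RintegralD//.
- apply: le_Rintegral => //.
  + exact: integrable_perturbed.
  + exact: integrable_perturbed_max.
  + by move=> w _; exact: (le_maxI _ (fun j => G j + eta * X j w)).
- exact: finite_measure_integrable_cst.
- by rewrite (_ : EFin \o _ = fun w => eta%:E * (EFin \o X i) w)%E//; exact: integrableZl.
Qed.

Lemma smooth_potential0 : 0 <= eta ->
  smooth_potential (fun=> 0) <= eta * \int[P]_w maxI (fun j => X j w).
Proof.
move=> eta0; have intM : P.-integrable setT (EFin \o (fun w => maxI (fun j => X j w))).
  by apply: integrable_maxI.
rewrite -RintegralZl//; apply: le_Rintegral => //.
- exact: integrable_perturbed_max.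
- by rewrite (_ : EFin \o _ =
    fun w => eta%:E * (EFin \o (fun w => maxI (fun j => X j w))) w)%E//; exact: integrableZl.
- move=> w _; apply: maxI_le => // i; rewrite add0r ler_wpM2l//.
  exact: (le_maxI _ (fun j => X j w)).
Qed.

(** A pointwise inequality, integrated: going from [G'] back to [G] raises the maximum by at least
    [s] where [i] wins at [G'], and never lowers it elsewhere. *)
Lemma smooth_potential_subgradient (G : 'I_N -> R) (i : 'I_N) (s : R) :
  let G' := fun j => G j + (if j == i then - s else 0) in
  0 <= s -> smooth_potential G' + s * grad G' i <= smooth_potential G.
Proof.
move=> G' s0.
have mA := measurable_argmax_event P N X eta G' i.
have -> : grad G' i = \int[P]_w \1_(argmax_event P N X eta G' i) w.
  by rewrite /Rintegral integral_indic// setIT.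
have intA : P.-integrable setT (EFin \o \1_(argmax_event P N X eta G' i)).
  exact: integrable_indic.
have intM := integrable_perturbed_max G'.
have intsA : P.-integrable setT
    (EFin \o (fun w => s * \1_(argmax_event P N X eta G' i) w)).
  by rewrite (_ : EFin \o _ =
    fun w => s%:E * (EFin \o \1_(argmax_event P N X eta G' i)) w)%E//; exact: integrableZl.
rewrite -RintegralZl// -RintegralD//; apply: le_Rintegral => //.
- rewrite (_ : EFin \o _ = (fun w => (maxI (fun j => G' j + eta * X j w))%R%:E) \+
    (fun w => (s * \1_(argmax_event P N X eta G' i) w)%R%:E))%E; first exact: integrableD.
  by apply/funext => w /=; rewrite EFinD.
- exact: integrable_perturbed_max.
move=> w _; rewrite indicE; have [wA|wA] := boolP (w \in _).
  rewrite mulr1; apply: le_trans (le_maxI _ (fun j => G j + eta * X j w) i).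
  have : maxI (fun j => G' j + eta * X j w) <= G' i + eta * X i w.
    apply: maxI_le => // j; have [->//|ji] := eqVneq j i.
    by rewrite ltW//; move: wA; rewrite inE => /(_ _ ji).
  by rewrite {2}/G' eqxx; lra.
rewrite mulr0 addr0; apply: maxI_le => // j.
apply: le_trans (le_maxI _ (fun j => G j + eta * X j w) j).
by rewrite lerD2r /G'; case: ifP => _; lra.
Qed.

End potential.

(** * Regret of GBPA *)

Lemma big_tuple_cons (V : nmodType) (T : finType) (n : nat) (F : n.+1.-tuple T -> V) :
  \sum_(s : n.+1.-tuple T) F s = \sum_(i : T) \sum_(s : n.-tuple T) F [tuple of i :: s].
Proof.
rewrite pair_bigA/=.
rewrite (reindex (fun p : T * n.-tuple T => [tuple of p.1 :: p.2]))//=.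
exists (fun s : n.+1.-tuple T => (thead s, [tuple of behead s])) => [[i s] _|s _] /=.
  by congr pair; apply: val_inj.
by rewrite [RHS]tuple_eta.
Qed.

(** The play is analysed for an abstract [grad] and [Phi]. In the application [m] is a lower bound
    on the mean of each scaled perturbation, and [B] bounds the weighted divergence of one arm in
    one round. *)
Section gbpa_analysis.
Context {R : realType} (N : nat) (grad : ('I_N -> R) -> 'I_N -> R)
  (Phi : ('I_N -> R) -> R) (m B : R).
Hypothesis N_gt0 : (0 < N)%N.
Hypothesis grad_ge0 : forall G i, 0 <= grad G i.
Hypothesis grad_sum : forall G, \sum_i grad G i = 1.
Hypothesis Phi_ge : forall G i, G i + m <= Phi G.
Hypothesis Phi_step : forall G i x, -1 <= x <= 0 ->
  grad G i * (Phi (fun j => G j + (if j == i then x / grad G i else 0)) - Phi G - x) <= B.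
Variable g : nat -> 'I_N -> R.

(** The learner's expected gain in [n] rounds from round [t] and estimate [G]; both are left free so
    that induction can follow the play. *)
Definition gbpa_gain (n t : nat) (G : 'I_N -> R) : R :=
  \sum_(s : n.-tuple 'I_N)
    gbpa_prob grad g t G s * \sum_(k < n) g (t + k)%N (tnth s k).

Lemma gbpa_prob_ge0 s t G : 0 <= gbpa_prob grad g t G s.
Proof. by elim: s t G => //= i s IH t G; exact: mulr_ge0. Qed.

Lemma gbpa_prob_sum n t G : \sum_(s : n.-tuple 'I_N) gbpa_prob grad g t G s = 1.
Proof.
elim: n t G => [|n IH] t G.
  by rewrite (big_pred1 [tuple]) => [|s]//=; apply/esym/eqP; exact: tuple0.
rewrite big_tuple_cons -(grad_sum G); apply: eq_bigr => i _ /=.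
by rewrite -mulr_sumr IH mulr1.
Qed.

Lemma gbpa_gainS n t G : gbpa_gain n.+1 t G =
  \sum_i grad G i * (g t i + gbpa_gain n t.+1 (gbpa_step grad g t G i)).
Proof.
rewrite /gbpa_gain big_tuple_cons; apply: eq_bigr => i _ /=.
rewrite -[g t i]mulr1 -(gbpa_prob_sum n t.+1 (gbpa_step grad g t G i)).
rewrite mulr_sumr -big_split/= mulr_sumr; apply: eq_bigr => s _.
rewrite -mulrA big_ord_recl/= addn0 tnth0 [g t i * _]mulrC -mulrDr.
congr (_ * (_ * (_ + _))); apply: eq_bigr => k _.
by rewrite addSnnS; congr (g _ _); rewrite (tnth_nth i) [RHS](tnth_nth i).
Qed.

(** Telescoping of [Phi]: each round trades the potential of the next estimate for the current one
    plus the gain received, at a cost [B] per arm. The comparator [i] is an arbitrary fixed arm. *)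
Lemma gbpa_gain_ge n t G i : (forall k j, (k < n)%N -> -1 <= g (t + k)%N j <= 0) ->
  G i + \sum_(k < n) g (t + k)%N i + m - Phi G - n%:R * (N%:R * B) <= gbpa_gain n t G.
Proof.
elim: n t G => [|n IH] t G g01.
  rewrite big_ord0 addr0 mul0r subr0.
  have -> : gbpa_gain 0 t G = 0.
    by rewrite /gbpa_gain big1// => s _; rewrite big_ord0 mulr0.
  by rewrite subr_le0 Phi_ge.
have gt01 j : -1 <= g t j <= 0 by have := g01 0%N j isT; rewrite addn0.
have IHstep j := IH t.+1 (gbpa_step grad g t G j)
  (fun k l kn => ltac:(rewrite addSnnS; exact: g01)).
pose S := \sum_(k < n) g (t.+1 + k)%N i.
have -> : \sum_(k < n.+1) g (t + k)%N i = g t i + S.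
  rewrite big_ord_recl addn0; congr (_ + _); apply: eq_bigr => k _.
  by rewrite addSnnS.
rewrite gbpa_gainS.
apply: (@le_trans _ _ (\sum_j (grad G j * (S + m - n%:R * (N%:R * B) - Phi G) +
    (grad G j * gbpa_step grad g t G j i - B)))); last first.
  apply: ler_sum => j _.
  have := ler_wpM2l (grad_ge0 G j) (IHstep j); rewrite -/S.
  have := Phi_step G j (g t j) (gt01 j); rewrite -/(gbpa_step grad g t G j).
  by nra.
rewrite big_split/= -mulr_suml grad_sum mul1r sumrB sumr_const card_ord -[B *+ N]mulr_natl.
(* Importance weighting makes the estimate of a gain unbiased whenever its arm has positive
   probability. *)
have : G i + g t i <= \sum_j grad G j * gbpa_step grad g t G j i.
  rewrite /gbpa_step.
  under eq_bigr do rewrite mulrDr.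
  rewrite big_split/= -mulr_suml grad_sum mul1r lerD2l.
  rewrite (bigD1 i)//= eqxx big1 => [|j ji]; last first.
    by rewrite eq_sym (negbTE ji) mulr0.
  (* If [grad G i = 0] the estimate of arm [i] never moves, which only
     overestimates its nonpositive gains. *)
  have [->|p0] := eqVneq (grad G i) 0.
    by rewrite mul0r add0r; case/andP: (gt01 i).
  by rewrite addr0 mulrC divfK.
rewrite -natr1; move: (N%:R * B) => NB; move: (\sum_j _) => U HU.
by nra.
Qed.

Lemma gbpa_regret_le (T : nat) : (forall t i, (t < T)%N -> -1 <= g t i <= 0) ->
  gbpa_expected_regret T grad g <= Phi (fun=> 0) - m + T%:R * (N%:R * B).
Proof.
move=> g01.
case: (@arg_maxP _ _ _ (Ordinal N_gt0) xpredT (fun i => \sum_(t < T) g t i) isT).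
move=> i _ imax.
have /= := @gbpa_gain_ge T 0 (fun=> 0) i g01.
(* The gains are fixed in advance, so the same best arm [i] attains the maximum for every sequence
   of draws. *)
suff : gbpa_expected_regret T grad g <=
    \sum_(t < T) g t i - gbpa_gain T 0 (fun=> 0) by lra.
rewrite -[X in X - _]mul1r -(gbpa_prob_sum T 0 (fun=> 0)) mulr_suml -sumrB.
apply: ler_sum => s _; rewrite -mulrBr ler_wpM2l ?gbpa_prob_ge0//.
by apply: maxI_le => // j; rewrite sumrB lerD2r; exact: imax.
Qed.

End gbpa_analysis.

(** With [x = - s p], the subgradient bounds the bracket by [s (p - p')]. In
    [p s (s / eta) ^ b p ^ b] the probability enters only through [p s = - x <= 1], so the bound is
    uniform in [p]. *)
Lemma smooth_potential_step (R : realType) (d : measure_display)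
  (Omega : measurableType d) (P : probability Omega R) (N : nat)
  (X : 'I_N -> {RV P >-> R}) (f : R -> R) (alpha C eta : R) :
  (0 < N)%N -> measurable_fun setT f -> (forall z, 0 <= f z) ->
  mutually_independent P (fun i => X i : Omega -> R) ->
  (forall i, has_density P (X i) f) ->
  (forall i, P.-integrable setT (EFin \o X i)) ->
  (forall z, cdf_of f z < 1) -> 0 <= alpha < 1 -> 0 < C ->
  (forall z, gen_hazard f alpha z <= C) -> 0 < eta ->
  let grad := smooth_grad P (fun i => X i : Omega -> R) eta in
  let Phi := smooth_potential P N X eta in
  forall G i x, -1 <= x <= 0 ->
  grad G i * (Phi (fun j => G j + (if j == i then x / grad G i else 0)) - Phi G - x)
  <= 2 * C / (1 - alpha) * eta^-1 `^ (1 - alpha).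
Proof.
move=> N_gt0 mf f_ge0 indX Xf intX F_lt1 alpha01 C_gt0 hazard_le eta_gt0 grad Phi G i x.
move=> /andP[x_ge x_le]; have b0 : 0 < 1 - alpha by case/andP: alpha01; rewrite subr_gt0.
have K0 : 0 <= 2 * C / (1 - alpha) by rewrite divr_ge0 ?(ltW b0)// mulr_ge0// ltW.
have [->|pN0] := eqVneq (grad G i) 0; first by rewrite mul0r mulr_ge0// powR_ge0.
have p_gt0 : 0 < grad G i by rewrite lt_neqAle eq_sym pN0; exact: smooth_grad_ge0.
pose s := - x / grad G i.
have s_ge0 : 0 <= s by rewrite divr_ge0 ?oppr_ge0// ltW.
have xs : x = - (s * grad G i) by rewrite divfK// opprK.
have -> : (fun j => G j + (if j == i then x / grad G i else 0)) =
    (fun j => G j + (if j == i then - s else 0)).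
  by apply/funext => j; rewrite /s mulNr opprK.
have sub := smooth_potential_subgradient P N X eta N_gt0 intX G i s s_ge0.
have inc := smooth_grad_shift_le P N X f eta mf f_ge0 indX Xf eta_gt0 alpha C
  F_lt1 alpha01 C_gt0 hazard_le G i s s_ge0 p_gt0.
rewrite /= -/grad -/Phi in sub inc; set p := grad G i in p_gt0 xs inc *.
set p' := grad _ i in sub inc; set Phi' := Phi (fun j => _) in sub *.
clearbody s p; apply: (@le_trans _ _ (p * s * (p - p'))).
  by rewrite -mulrA ler_pM2l// xs; lra.
have ps1 : p * s <= 1 by rewrite mulrC; lra.
have ps0 : 0 <= p * s by rewrite mulr_ge0// ltW.
apply: (le_trans (ler_wpM2l ps0 inc)).
rewrite [leLHS](_ : _ =
    2 * C / (1 - alpha) *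
      ((p * s) * ((p * s) `^ (1 - alpha) * eta^-1 `^ (1 - alpha)))); last first.
  by rewrite !powRM ?invr_ge0 ?(ltW eta_gt0) ?(ltW p_gt0)//; ring.
rewrite ler_wpM2l// mulrA ler_piMl ?powR_ge0// mulr_ile1 ?powR_ge0//.
have : (p * s) `^ (1 - alpha) <= 1 `^ (1 - alpha).
  by apply: ge0_ler_powR; rewrite ?nnegrE//; exact: ltW.
by rewrite powR1.
Qed.

(** * Learning rate and sublinearity *)

(** [eta] solves [eta ^ (2 - alpha) = 2 C M / ((1 - alpha) Q)], which equates the divergence cost
    with the perturbation cost [eta Q]; [M] stands for [N T]. The power of [Q] comes from [1 - 1 /
    (2 - alpha) = (1 - alpha) / (2 - alpha)]. *)
Lemma learning_rate_balance (R : realType) (alpha C Q M : R) :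
  0 <= alpha < 1 -> 0 < C -> 0 < Q -> 0 < M ->
  let eta := (2 * C * M / ((1 - alpha) * Q)) `^ (1 / (2 - alpha)) in
  [/\ 0 < eta,
      M * (2 * C / (1 - alpha) * eta^-1 `^ (1 - alpha)) = eta * Q
    & (2 * C / (1 - alpha)) `^ (1 / (2 - alpha)) * M `^ (1 / (2 - alpha))
        * Q `^ ((1 - alpha) / (2 - alpha)) = eta * Q].
Proof.
move=> /andP[a0 a1] C0 Q0 M0 eta.
have b0 : 0 < 1 - alpha by rewrite subr_gt0.
have c0 : 0 < 2 - alpha by lra.
have D0 : 0 < 2 * C * M / ((1 - alpha) * Q) by rewrite divr_gt0 ?mulr_gt0.
have eta0 : 0 < eta by exact: powR_gt0.
split => //.
  have etaD : eta `^ (1 - alpha) * eta = 2 * C * M / ((1 - alpha) * Q).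
    rewrite -[X in _ * X]powRr1 ?(ltW eta0)// -powRD; last by rewrite (gt_eqF eta0) implybT.
    have -> : 1 - alpha + 1 = 2 - alpha by ring.
    rewrite /eta -powRrM mul1r mulVf ?gt_eqF// powRr1//; exact: ltW.
  have etab : eta `^ (1 - alpha) != 0 by rewrite gt_eqF// powR_gt0.
  rewrite -[eta^-1]powR_inv1 ?(ltW eta0)// -powRrM mulN1r powRN.
  move: (eta `^ _) etab etaD => e e0 etaD; apply: (mulIf e0).
  have -> : eta * Q * e = e * eta * Q by ring.
  by rewrite etaD; field; rewrite e0 !gt_eqF.
rewrite /eta.
have -> : 2 * C * M / ((1 - alpha) * Q) = 2 * C / (1 - alpha) * M * Q^-1.
  by field; rewrite !gt_eqF.
have K0 : 0 < 2 * C / (1 - alpha) by rewrite divr_gt0// mulr_gt0.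
move: (2 * C / (1 - alpha)) K0 => K K0.
rewrite !powRM ?mulr_ge0 ?invr_ge0 ?(ltW K0) ?(ltW M0) ?(ltW Q0)//.
rewrite -!mulrA; congr (_ * (_ * _)).
rewrite [RHS](_ : _ = Q `^ (-1 * (1 / (2 - alpha)) + 1)); last first.
  rewrite powRD; last by rewrite (gt_eqF Q0) implybT.
  by rewrite [Q `^ (-1 * _)]powRrM powR_inv1 ?powRr1// ltW.
by congr (_ `^ _); field; rewrite gt_eqF.
Qed.

Lemma powR_sublinear (R : realType) (r : R) : 0 < r < 1 ->
  (fun T : nat => T%:R `^ r / T%:R) @ \oo --> (0 : R).
Proof.
move=> /andP[r0 r1].
have -> : (fun T : nat => T%:R `^ r / T%:R) = (fun T : nat => (T%:R^-1 : R) `^ (1 - r)).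
  (* At [T = 0] both sides vanish because the inverse of [0] is [0]. *)
  apply/funext => -[|T]; first by rewrite !invr0 mulr0 powR0// gt_eqF// subr_gt0.
  have T0 : (T.+1%:R : R) != 0 by rewrite pnatr_eq0.
  rewrite -[in RHS]powR_inv1// -powRrM mulN1r opprB powRB ?T0 ?implybT//.
  by rewrite powRr1.
have inv0 : (T%:R^-1 : R) @[T --> \oo] --> 0^'+.
  move=> A A0; have inv0 : (T%:R^-1 : R) @[T --> \oo] --> (0 : R).
    by rewrite -cvg_shiftS; exact: cvg_harmonic.
  have A1 : \forall T \near \oo, 0 < (T%:R^-1 : R) -> A T%:R^-1 := inv0 _ A0.
  change (\forall T \near \oo, A (T%:R^-1)).
  apply: filterS2 A1 (nbhs_infty_gt 0%N) => T AT T0.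
  by apply: AT; rewrite invr_gt0 ltr0n.
have r1' : 0 < 1 - r by rewrite subr_gt0.
exact: (cvg_comp _ _ inv0 (powR_cvg0 r1')).
Qed.

Theorem theorem3 (R : realType) (d : measure_display) (Omega : measurableType d)
  (P : probability Omega R) (N : nat) (X : 'I_N -> {RV P >-> R})
  (f : R -> R) (alpha C Q : R) :
  (0 < N)%N ->
  (* Z has density f: f is a measurable nonnegative function, and the
     Z_i = X i are i.i.d. copies of Z, each with density f *)
  measurable_fun setT f -> (forall z, 0 <= f z) ->
  mutually_independent P (fun i => X i : Omega -> R) ->
  (forall i, has_density P (X i) f) ->
  (* finite expectation *)
  (@lebesgue_measure R).-integrable setT (fun z => (z * f z)%:E) ->
  (* support unbounded on the right *)
  (forall z, cdf_of f z < 1) ->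
  0 <= alpha < 1 -> 0 < C ->
  (forall z, gen_hazard f alpha z <= C) ->
  0 < Q ->
  (forall i0 : 'I_N,
    ('E_P[fun w => maxI (fun i => X i w)] - 'E_P[X i0] <= Q%:E)%E) ->
  (forall T : nat,
    let eta := (2 * C * N%:R * T%:R / ((1 - alpha) * Q)) `^ (1 / (2 - alpha)) in
    forall g : nat -> 'I_N -> R,
      (forall t i, (t < T)%N -> -1 <= g t i <= 0) ->
      gbpa_expected_regret T (smooth_grad P (fun i => X i : Omega -> R) eta) g
      <= 2 * (2 * C / (1 - alpha)) `^ (1 / (2 - alpha))
           * (N%:R * T%:R) `^ (1 / (2 - alpha))
           * Q `^ ((1 - alpha) / (2 - alpha)))
  /\
  (* in particular the regret bound is sublinear in T *)
  ((fun T : nat =>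
      2 * (2 * C / (1 - alpha)) `^ (1 / (2 - alpha))
        * (N%:R * T%:R) `^ (1 / (2 - alpha))
        * Q `^ ((1 - alpha) / (2 - alpha)) / T%:R) @ \oo --> (0 : R)).
Proof.
move=> N_gt0 mf f_ge0 indX Xf intf F_lt1 alpha01 C_gt0 hazard_le Q_gt0 maxQ.
have [a0 a1] := andP alpha01; split; last first.
  have r01 : 0 < 1 / (2 - alpha) < 1 by rewrite divr_gt0 ?ltr_pdivrMr; lra.
  pose c := 2 * (2 * C / (1 - alpha)) `^ (1 / (2 - alpha)) *
    N%:R `^ (1 / (2 - alpha)) * Q `^ ((1 - alpha) / (2 - alpha)).
  have := cvgM (cvg_cst c) (powR_sublinear R _ r01); rewrite mulr0 => cvg_c.
  rewrite [X in X @ _](_ : _ = fun T : nat => c * (T%:R `^ (1 / (2 - alpha)) / T%:R)).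
    exact: cvg_c.
  by apply/funext => T; rewrite [(N%:R * T%:R) `^ _]powRM ?ler0n// /c; ring.
move=> T eta g g01.
(* For [T = 0] the perturbation scale vanishes. *)
case: (posnP T) => [T0|T_gt0].
  rewrite /gbpa_expected_regret big1 => [|s _].
    by rewrite !mulr_ge0 ?powR_ge0.
  suff -> : maxI (fun i => \sum_(t < T) (g t i - g t (tnth s t))) = 0 by rewrite mulr0.
  have [i ->] := maxI_eq N N_gt0 (fun i => \sum_(t < T) (g t i - g t (tnth s t))).
  by apply: big1 => -[t tT]; exfalso; move: tT; rewrite T0.
have M_gt0 : 0 < N%:R * T%:R :> R by rewrite mulr_gt0 ?ltr0n.
have [] := learning_rate_balance R alpha C Q _ alpha01 C_gt0 Q_gt0 M_gt0.
rewrite [2 * C * (N%:R * T%:R)]mulrA -/eta => eta_gt0 step_eq bound_eq.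
have intX i : P.-integrable setT (EFin \o X i) by exact: density_integrable (Xf i) intf.
have intM : P.-integrable setT (EFin \o (fun w => maxI (fun j => X j w))).
  exact: integrable_maxI.
(* The hypothesis on [Q] places this [m] below every mean, and [Phi 0 - eta m] is then at most
   [eta Q]. *)
pose m := \int[P]_w maxI (fun j => X j w) - Q.
have m_le i : m <= \int[P]_w X i w.
  have := maxQ i; rewrite unlock => H; rewrite lerBlDl -lerBlDr -lee_fin EFinB.
  rewrite /Rintegral !fineK; first exact: H.
    exact: integrable_fin_num (intX i).
  exact: integrable_fin_num intM.
have reg : gbpa_expected_regret T (smooth_grad P (fun i => X i : Omega -> R) eta) g <=
    smooth_potential P N X eta (fun=> 0) - eta * m +
    T%:R * (N%:R * (2 * C / (1 - alpha) * eta^-1 `^ (1 - alpha))).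
  apply: gbpa_regret_le => //.
  - by move=> G i; exact: smooth_grad_ge0.
  - by move=> G; exact: (sum_smooth_grad _ _ _ f).
  - move=> G i; apply: le_trans (le_smooth_potential P N X eta N_gt0 intX G i).
    by rewrite lerD2l ler_pM2l.
  - exact: (smooth_potential_step _ _ _ _ _ _ f).
apply: (le_trans reg).
have := smooth_potential0 P N X eta N_gt0 intX (ltW eta_gt0).
rewrite [X in _ -> _ <= X](_ : _ = 2 * (eta * Q)); last by rewrite -bound_eq !mulrA.
by rewrite [T%:R * (_ * _)]mulrA [T%:R * N%:R]mulrC step_eq /m; lra.
Qed.
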